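(* Let $K$ be a commutative field, $\mathcal{F}:\mathfrak{C}\to\mathfrak{D}$ a $K$-linear unitary pseudofunctor between $K$-linear 2-categories, $n\ge 1$, and let a purely pseudofunctorial $n^{th}$-order deformation of $\mathcal{F}$ be given, with structural families $\widehat{\mathcal{F}}^k=\{\widehat{\mathcal{F}}^k_{X,Y,Z}\}$ and $\{\mathcal{F}^k_0(X)\}$, $k=1,\ldots,n$. Let $\Psi\in X^3(\mathcal{F})$ be the obstruction to extending this deformation one order higher, i.e. (with $\widehat{\mathcal{F}}^0=\widehat{\mathcal{F}}$) $$\Psi(f,g,l)=\sum_{\substack{p+q=n+1\\0\le p,q\le n}}\widehat{\mathcal{F}}^p(g\circ f,l)\cdot\left(1_{\mathcal{F}(l)}\circ\widehat{\mathcal{F}}^q(f,g)\right)-\sum_{\substack{p+q=n+1\\0\le p,q\le n}}\widehat{\mathcal{F}}^p(f,l\circ g)\cdot\left(\widehat{\mathcal{F}}^q(g,l)\circ 1_{\mathcal{F}(f)}\right)$$ for all paths $X\stackrel{f}{\to}Y\stackrel{g}{\to}Z\stackrel{l}{\to}T$ in $\mathfrak{C}$. Then $\Psi$ is a 3-cocycle of the deformation complex $X^{\bullet}(\mathcal{F})$, i.e. $\delta(\Psi)=0$. If the class of $\Psi$ in $H^3(X^{\bullet}(\mathcal{F}))$ is zero, then there exists a purely pseudofunctorial $(n+1)^{th}$-order deformation of $\mathcal{F}$ extending the given one.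
   Context: 2-categories are strict. Vertical composition of 2-morphisms is $\cdot$; horizontal composition and composition of 1-morphisms is $\circ$. A $K$-linear 2-category has $K$-linear hom-categories and $K$-bilinear composition functors. A $K$-linear pseudofunctor $\mathcal{F}:\mathfrak{C}\to\mathfrak{D}$ consists of an object map, $K$-linear functors $\mathcal{F}_{X,Y}:\mathfrak{C}(X,Y)\to\mathfrak{D}(\mathcal{F}(X),\mathcal{F}(Y))$, 2-isomorphisms $\widehat{\mathcal{F}}(f,g):\mathcal{F}(g)\circ\mathcal{F}(f)\Rightarrow\mathcal{F}(g\circ f)$ for $X\stackrel{f}{\to}Y\stackrel{g}{\to}Z$, natural in $(f,g)$ (forming a natural isomorphism $\widehat{\mathcal{F}}_{X,Y,Z}$), and 2-isomorphisms $\mathcal{F}_0(X):\mathcal{F}(\mathrm{id}_X)\Rightarrow\mathrm{id}_{\mathcal{F}(X)}$, such that (A1) $\widehat{\mathcal{F}}(g\circ f,l)\cdot(1_{\mathcal{F}(l)}\circ\widehat{\mathcal{F}}(f,g))=\widehat{\mathcal{F}}(f,l\circ g)\cdot(\widehat{\mathcal{F}}(g,l)\circ 1_{\mathcal{F}(f)})$ for all composable $f,g,l$; (A2) $\widehat{\mathcal{F}}(\mathrm{id}_X,f)=1_{\mathcal{F}(f)}\circ\mathcal{F}_0(X)$ and $\widehat{\mathcal{F}}(f,\mathrm{id}_Y)=\mathcal{F}_0(Y)\circ 1_{\mathcal{F}(f)}$ for $f:X\to Y$. It is unitary if every $\mathcal{F}_0(X)$ is an identity. A purely pseudofunctorial $n^{th}$-order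 deformation of $\mathcal{F}$ deforms only the pseudofunctorial structure over $K[h]/(h^{n+1})$: it is given by families of 2-morphisms $\widehat{\mathcal{F}}^k(f,g):\mathcal{F}(g)\circ\mathcal{F}(f)\Rightarrow\mathcal{F}(g\circ f)$ natural in $(f,g)$ (i.e. natural transformations $\widehat{\mathcal{F}}^k_{X,Y,Z}$ for all $X,Y,Z$) and 2-morphisms $\mathcal{F}^k_0(X):\mathcal{F}(\mathrm{id}_X)\Rightarrow\mathrm{id}_{\mathcal{F}(X)}$, $k=1,\ldots,n$, such that, with $\widehat{\mathcal{F}}^0=\widehat{\mathcal{F}}$ and $\mathcal{F}_0^0=\mathcal{F}_0$, the sums $\sum_{k=0}^n\widehat{\mathcal{F}}^k h^k$ and $\sum_{k=0}^n\mathcal{F}^k_0h^k$ satisfy (A1) and (A2) modulo $h^{n+1}$ (2-morphisms being multiplied, both vertically and horizontally, by the product rule for polynomials in $h$). An $(n+1)^{th}$-order deformation extends it if its terms of orders $k\le n$ are the given ones. Deformation complex. For $m\ge1$, $X^m(\mathcal{F})$ is the $K$-module of families, indexed by $(X_0,\ldots,X_m)\in|\mathfrak{C}|^{m+1}$, of natural transformations with components $\varphi(f_0,\ldots,f_{m-1}):\mathcal{F}(f_{m-1})\circ\cdots\circ\mathcal{F}(f_0)\Rightarrow\mathcal{F}(f_{m-1}\circ\cdots\circ f_0)$, $f_i:X_i\to X_{i+1}$, natural in all the $f_i$ (no condition relates different tuples of objects); $X^m(\mathcal{F})=0$ otherwise. The coboundary $\delta:X^{m-1}(\mathcal{F})\to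 X^m(\mathcal{F})$, $m\ge 2$, is $$\begin{aligned}(\delta\varphi)(f_0,\ldots,f_{m-1})=\ &\widehat{\mathcal{F}}(f_0,f_{m-1}\circ\cdots\circ f_1)\cdot\left(\varphi(f_1,\ldots,f_{m-1})\circ 1_{\mathcal{F}(f_0)}\right)\\&+\sum_{i=1}^{m-1}(-1)^i\varphi(f_0,\ldots,f_i\circ f_{i-1},\ldots,f_{m-1})\cdot\left(1_{\mathcal{F}(f_{m-1})\circ\cdots\circ\mathcal{F}(f_{i+1})}\circ\widehat{\mathcal{F}}(f_{i-1},f_i)\circ 1_{\mathcal{F}(f_{i-2})\circ\cdots\circ\mathcal{F}(f_0)}\right)\\&+(-1)^m\,\widehat{\mathcal{F}}(f_{m-2}\circ\cdots\circ f_0,f_{m-1})\cdot\left(1_{\mathcal{F}(f_{m-1})}\circ\varphi(f_0,\ldots,f_{m-2})\right).\end{aligned}$$ $H^3(X^{\bullet}(\mathcal{F}))$ is its third cohomology. *)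

(* Defs.v *)
From HB Require Import structures.
From mathcomp Require Import all_boot all_order all_algebra.
Set Implicit Arguments.
Unset Strict Implicit.
Unset Printing Implicit Defensive.
Import GRing.Theory.
Local Open Scope ring_scope.

Declare Scope twocat_scope.
Delimit Scope twocat_scope with two.
Local Open Scope twocat_scope.

(* Strictness identifies 1-morphisms only up to propositional equality, so      *)
(* 2-morphisms have to be transported along such equalities.  The choice of the *)
(* equality proof is irrelevant (proof irrelevance).                            *)
Definition transport2 (K : fieldType) (T : Type) (two : T -> T -> lmodType K)
  (f f' g g' : T) (ef : f = f') (eg : g = g') (a : two f g) : two f' g' :=
  match ef in _ = x, eg in _ = y return two x y with
  | erefl, erefl => a
  end.

Record linTwoCat (K : fieldType) := LinTwoCat {
  ob :> Type;
  mor : ob -> ob -> Type;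
  two : forall X Y : ob, mor X Y -> mor X Y -> lmodType K;
  id1 : forall X : ob, mor X X;
  comp1 : forall X Y Z : ob, mor Y Z -> mor X Y -> mor X Z;
  id2 : forall (X Y : ob) (f : mor X Y), two f f;
  vcomp : forall (X Y : ob) (f g h : mor X Y), two g h -> two f g -> two f h;
  hcomp : forall (X Y Z : ob) (f f' : mor X Y) (g g' : mor Y Z),
    two g g' -> two f f' -> two (comp1 g f) (comp1 g' f');
  comp1A : forall (X Y Z T : ob) (l : mor Z T) (g : mor Y Z) (f : mor X Y),
    comp1 l (comp1 g f) = comp1 (comp1 l g) f;
  comp1_idl : forall (X Y : ob) (f : mor X Y), comp1 (id1 Y) f = f;
  comp1_idr : forall (X Y : ob) (f : mor X Y), comp1 f (id1 X) = f;
  vcompA : forall (X Y : ob) (f g h k : mor X Y)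
    (c : two h k) (b : two g h) (a : two f g),
    vcomp c (vcomp b a) = vcomp (vcomp c b) a;
  vcomp_idl : forall (X Y : ob) (f g : mor X Y) (a : two f g),
    vcomp (id2 g) a = a;
  vcomp_idr : forall (X Y : ob) (f g : mor X Y) (a : two f g),
    vcomp a (id2 f) = a;
  hcomp_id2 : forall (X Y Z : ob) (f : mor X Y) (g : mor Y Z),
    hcomp (id2 g) (id2 f) = id2 (comp1 g f);
  interchange2 : forall (X Y Z : ob) (f f' f'' : mor X Y) (g g' g'' : mor Y Z)
    (b' : two g' g'') (b : two g g') (a' : two f' f'') (a : two f f'),
    hcomp (vcomp b' b) (vcomp a' a) = vcomp (hcomp b' a') (hcomp b a);
  hcompA : forall (X Y Z T : ob) (f f' : mor X Y) (g g' : mor Y Z)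
    (l l' : mor Z T) (c : two l l') (b : two g g') (a : two f f'),
    transport2 (comp1A l g f) (comp1A l' g' f') (hcomp c (hcomp b a))
    = hcomp (hcomp c b) a;
  hcomp_idl : forall (X Y : ob) (f g : mor X Y) (a : two f g),
    transport2 (comp1_idl f) (comp1_idl g) (hcomp (id2 (id1 Y)) a) = a;
  hcomp_idr : forall (X Y : ob) (f g : mor X Y) (a : two f g),
    transport2 (comp1_idr f) (comp1_idr g) (hcomp a (id2 (id1 X))) = a;
  vcomp_linl : forall (X Y : ob) (f g h : mor X Y) (a : two f g),
    linear (fun b : two g h => vcomp b a);
  vcomp_linr : forall (X Y : ob) (f g h : mor X Y) (b : two g h),
    linear (fun a : two f g => vcomp b a);
  hcomp_linl : forall (X Y Z : ob) (f f' : mor X Y) (g g' : mor Y Z)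
    (a : two f f'), linear (fun b : two g g' => hcomp b a);
  hcomp_linr : forall (X Y Z : ob) (f f' : mor X Y) (g g' : mor Y Z)
    (b : two g g'), linear (fun a : two f f' => hcomp b a)
}.

Arguments mor {K l0} X Y.
Arguments two {K l0 X Y} f g.
Arguments id1 {K l0} X.
Arguments comp1 {K l0 X Y Z} g f.
Arguments id2 {K l0 X Y} f.
Arguments vcomp {K l0 X Y f g h} b a.
Arguments hcomp {K l0 X Y Z f f' g g'} b a.
Arguments comp1A {K l0 X Y Z T} l g f.
Arguments comp1_idl {K l0 X Y} f.
Arguments comp1_idr {K l0 X Y} f.

Notation "g '\o1' f" := (comp1 g f)
  (at level 40, left associativity) : twocat_scope.
Notation "b '\v' a" := (vcomp b a)
  (at level 45, left associativity) : twocat_scope.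
Notation "b '\h' a" := (hcomp b a)
  (at level 40, left associativity) : twocat_scope.

Definition cast2 (K : fieldType) (C : linTwoCat K) (X Y : C)
  (f f' g g' : mor X Y) (ef : f = f') (eg : g = g') (a : two f g) : two f' g' :=
  transport2 ef eg a.

Definition is_iso2 (K : fieldType) (C : linTwoCat K) (X Y : C) (f g : mor X Y)
  (a : two f g) : Prop :=
  exists b : two g f, b \v a = id2 f /\ a \v b = id2 g.

Record pseudofunctor (K : fieldType) (C D : linTwoCat K) := Pseudofunctor {
  F0 :> C -> D;
  F1 : forall X Y : C, mor X Y -> mor (F0 X) (F0 Y);
  F2 : forall (X Y : C) (f g : mor X Y), two f g -> two (F1 f) (F1 g);
  Fhat : forall (X Y Z : C) (f : mor X Y) (g : mor Y Z),
    two (F1 g \o1 F1 f) (F1 (g \o1 f));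
  Funit : forall X : C, two (F1 (id1 X)) (id1 (F0 X));
  F2_lin : forall (X Y : C) (f g : mor X Y), linear (@F2 X Y f g);
  F2_id : forall (X Y : C) (f : mor X Y), F2 (id2 f) = id2 (F1 f);
  F2_vcomp : forall (X Y : C) (f g h : mor X Y) (b : two g h) (a : two f g),
    F2 (b \v a) = F2 b \v F2 a;
  Fhat_iso : forall (X Y Z : C) (f : mor X Y) (g : mor Y Z),
    is_iso2 (Fhat f g);
  Fhat_natural : forall (X Y Z : C) (f f' : mor X Y) (g g' : mor Y Z)
    (a : two f f') (b : two g g'),
    Fhat f' g' \v (F2 b \h F2 a) = F2 (b \h a) \v Fhat f g;
  Funit_iso : forall X : C, is_iso2 (Funit X);
  Fhat_A1 : forall (X Y Z T : C) (f : mor X Y) (g : mor Y Z) (l : mor Z T),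
    cast2 (comp1A (F1 l) (F1 g) (F1 f)) (f_equal (@F1 X T) (comp1A l g f))
      (Fhat (g \o1 f) l \v (id2 (F1 l) \h Fhat f g))
    = Fhat f (l \o1 g) \v (Fhat g l \h id2 (F1 f));
  Fhat_A2r : forall (X Y : C) (f : mor X Y),
    cast2 erefl (f_equal (@F1 X Y) (comp1_idr f)) (Fhat (id1 X) f)
    = cast2 erefl (comp1_idr (F1 f)) (id2 (F1 f) \h Funit X);
  Fhat_A2l : forall (X Y : C) (f : mor X Y),
    cast2 erefl (f_equal (@F1 X Y) (comp1_idl f)) (Fhat f (id1 Y))
    = cast2 erefl (comp1_idl (F1 f)) (Funit Y \h id2 (F1 f))
}.

Arguments F1 {K C D} p {X Y} _.
Arguments F2 {K C D} p {X Y f g} _.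
Arguments Fhat {K C D} p {X Y Z} f g.
Arguments Funit {K C D} p X.

Definition unitary (K : fieldType) (C D : linTwoCat K) (F : pseudofunctor C D)
  : Prop :=
  forall X : C, exists e : F1 F (id1 X) = id1 (F X),
    Funit F X = cast2 erefl e (id2 (F1 F (id1 X))).

(* Polynomials (or series) in h with 2-morphisms as coefficients: the value at  *)
(* k is the coefficient of h^k.                                                 *)
Section FormalCells.
Context {K : fieldType} {C : linTwoCat K}.

Definition hcell (X Y : C) (f g : mor X Y) := nat -> two f g.

Definition hconst (X Y : C) (f g : mor X Y) (a : two f g) : hcell f g :=
  fun k => if k == 0%N then a else 0.

Definition htrunc (n : nat) (X Y : C) (f g : mor X Y) (a : hcell f g)
  : hcell f g := fun k => if (k <= n)%N then a k else 0.

Definition hvcomp (X Y : C) (f g h : mor X Y) (b : hcell g h) (a : hcell f g)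
  : hcell f h := fun k => \sum_(i < k.+1) (b i \v a (k - i)%N).

Definition hhcomp (X Y Z : C) (f f' : mor X Y) (g g' : mor Y Z)
  (b : hcell g g') (a : hcell f f') : hcell (g \o1 f) (g' \o1 f') :=
  fun k => \sum_(i < k.+1) (b i \h a (k - i)%N).

Definition hcast (X Y : C) (f f' g g' : mor X Y) (ef : f = f') (eg : g = g')
  (a : hcell f g) : hcell f' g' := fun k => cast2 ef eg (a k).

(* congruence modulo h^(n+1) *)
Definition heqmod (n : nat) (X Y : C) (f g : mor X Y) (a b : hcell f g) : Prop :=
  forall k : nat, (k <= n)%N -> a k = b k.

End FormalCells.

(* Only the coefficients of order k <= n are constrained or used; those of      *)
(* order k > n are meaningless.                                                 *)
Record ppDeformation (K : fieldType) (C D : linTwoCat K)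
  (F : pseudofunctor C D) (n : nat) := PPDeformation {
  dhat : nat -> forall (X Y Z : C) (f : mor X Y) (g : mor Y Z),
    two (F1 F g \o1 F1 F f) (F1 F (g \o1 f));
  dunit : nat -> forall X : C, two (F1 F (id1 X)) (id1 (F X));
  dhatP X Y Z (f : mor X Y) (g : mor Y Z) :
    hcell (F1 F g \o1 F1 F f) (F1 F (g \o1 f)) :=
    htrunc n (fun k => dhat k f g);
  dunitP X : hcell (F1 F (id1 X)) (id1 (F X)) := htrunc n (fun k => dunit k X);
  dhat0 : forall (X Y Z : C) (f : mor X Y) (g : mor Y Z),
    dhat 0 f g = Fhat F f g;
  dunit0 : forall X : C, dunit 0 X = Funit F X;
  dhat_natural : forall k : nat, (1 <= k <= n)%N ->
    forall (X Y Z : C) (f f' : mor X Y) (g g' : mor Y Z)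
      (a : two f f') (b : two g g'),
    dhat k f' g' \v (F2 F b \h F2 F a) = F2 F (b \h a) \v dhat k f g;
  dhat_A1 : forall (X Y Z T : C) (f : mor X Y) (g : mor Y Z) (l : mor Z T),
    heqmod n
      (hcast (comp1A (F1 F l) (F1 F g) (F1 F f))
             (f_equal (@F1 _ _ _ F X T) (comp1A l g f))
        (hvcomp (dhatP (g \o1 f) l)
                (hhcomp (hconst (id2 (F1 F l))) (dhatP f g))))
      (hvcomp (dhatP f (l \o1 g))
              (hhcomp (dhatP g l) (hconst (id2 (F1 F f)))));
  dhat_A2r : forall (X Y : C) (f : mor X Y),
    heqmod n
      (hcast erefl (f_equal (@F1 _ _ _ F X Y) (comp1_idr f)) (dhatP (id1 X) f))
      (hcast erefl (comp1_idr (F1 F f))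
        (hhcomp (hconst (id2 (F1 F f))) (dunitP X)));
  dhat_A2l : forall (X Y : C) (f : mor X Y),
    heqmod n
      (hcast erefl (f_equal (@F1 _ _ _ F X Y) (comp1_idl f)) (dhatP f (id1 Y)))
      (hcast erefl (comp1_idl (F1 F f))
        (hhcomp (dunitP Y) (hconst (id2 (F1 F f)))))
}.

Arguments dhat {K C D F n} p _ {X Y Z} f g.
Arguments dunit {K C D F n} p _ X.

Definition extends (K : fieldType) (C D : linTwoCat K) (F : pseudofunctor C D)
  (n : nat) (d : ppDeformation F n) (d' : ppDeformation F n.+1) : Prop :=
  forall k : nat, (k <= n)%N ->
    (forall (X Y Z : C) (f : mor X Y) (g : mor Y Z), dhat d' k f g = dhat d k f g)
    /\ (forall X : C, dunit d' k X = dunit d k X).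

Section Paths.
Context {K : fieldType} {C : linTwoCat K}.

(* [mpath m X Y]: composable sequences (f_0, ..., f_m) of m+1 arrows from X to  *)
(* Y, with f_0 first.                                                           *)
Fixpoint mpath (m : nat) (X Y : C) : Type :=
  match m with
  | 0 => mor X Y
  | m'.+1 => {Z : C & (mor X Z * mpath m' Z Y)%type}
  end.

Definition pcons (m : nat) (X Z Y : C) (f : mor X Z) (p : mpath m Z Y)
  : mpath m.+1 X Y := existT _ Z (f, p).

Definition path_case (m : nat) (X Y : C) (P : mpath m.+1 X Y -> Type)
  (P_cons : forall (Z : C) (f : mor X Z) (q : mpath m Z Y), P (pcons f q))
  (p : mpath m.+1 X Y) : P p :=
  match p with existT Z (f, q) => P_cons Z f q end.

(* f_m \o ... \o f_0 *)
Fixpoint pcomp (m : nat) (X Y : C) : mpath m X Y -> mor X Y :=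
  match m with
  | 0 => fun f => f
  | m'.+1 => fun p => let: existT Z (f, q) := p in pcomp q \o1 f
  end.

(* (f_0, ..., f_(i+1) \o f_i, ..., f_(m+1)), meaningful for i <= m *)
Fixpoint contract (m : nat) (i : nat) (X Y : C) : mpath m.+1 X Y -> mpath m X Y :=
  match m with
  | 0 => fun p => let: existT Z (f, g) := p in g \o1 f
  | m'.+1 => fun p => let: existT Z (f, q) := p in
    match i with
    | 0 => let: existT W (g, r) := q in pcons (g \o1 f) r
    | i'.+1 => pcons f (contract i' q)
    end
  end.

Lemma pcomp_contract (m i : nat) (X Y : C) (p : mpath m.+1 X Y) :
  pcomp (contract i p) = pcomp p.
Proof.
elim: m i X Y p => [|m IHm] i X Y [Z [f q]] //.
case: i => [|i]; first by case: q => W [g r]; exact: comp1A.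
exact: (f_equal (fun h => h \o1 f) (IHm i Z Y q)).
Qed.

(* ((f_0, ..., f_m), f_(m+1)) *)
Fixpoint unsnoc (m : nat) (X Y : C)
  : mpath m.+1 X Y -> {W : C & (mpath m X W * mor W Y)%type} :=
  match m with
  | 0 => fun p => p
  | m'.+1 => fun p => let: existT Z (f, q) := p in
    let: existT W (r, l) := unsnoc q in existT _ W (pcons f r, l)
  end.

Definition pmid (m : nat) (X Y : C) (p : mpath m.+1 X Y) : C :=
  projT1 (unsnoc p).
Definition pinit (m : nat) (X Y : C) (p : mpath m.+1 X Y) : mpath m X (pmid p) :=
  (projT2 (unsnoc p)).1.
Definition plast (m : nat) (X Y : C) (p : mpath m.+1 X Y) : mor (pmid p) Y :=
  (projT2 (unsnoc p)).2.

Lemma pcomp_unsnoc (m : nat) (X Y : C) (p : mpath m.+1 X Y) :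
  plast p \o1 pcomp (pinit p) = pcomp p.
Proof.
rewrite /plast /pinit /pmid.
elim: m X Y p => [|m IHm] X Y [Z [f q]] //=.
by move: (IHm _ _ q); case: (unsnoc q) => W [r l] /= <-; exact: comp1A.
Qed.

(* A path of 2-morphisms: a path (f_i) (its source), a parallel path (f'_i)     *)
(* through the same objects (its target), and 2-morphisms f_i => f'_i.          *)
Definition cell (X Y : C) : Type := {f : mor X Y & {f' : mor X Y & two f f'}}.

Fixpoint path2 (m : nat) (X Y : C) : Type :=
  match m with
  | 0 => cell X Y
  | m'.+1 => {Z : C & (cell X Z * path2 m' Z Y)%type}
  end.

Definition csrc (X Y : C) (c : cell X Y) : mor X Y := projT1 c.
Definition ctgt (X Y : C) (c : cell X Y) : mor X Y := projT1 (projT2 c).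
Definition ccell (X Y : C) (c : cell X Y) : two (csrc c) (ctgt c) :=
  projT2 (projT2 c).

Fixpoint psrc (m : nat) (X Y : C) : path2 m X Y -> mpath m X Y :=
  match m with
  | 0 => fun c => csrc c
  | m'.+1 => fun a => let: existT Z (c, b) := a in pcons (csrc c) (psrc b)
  end.

Fixpoint ptgt (m : nat) (X Y : C) : path2 m X Y -> mpath m X Y :=
  match m with
  | 0 => fun c => ctgt c
  | m'.+1 => fun a => let: existT Z (c, b) := a in pcons (ctgt c) (ptgt b)
  end.

Fixpoint pcomp2 (m : nat) (X Y : C)
  : forall a : path2 m X Y, two (pcomp (psrc a)) (pcomp (ptgt a)) :=
  match m with
  | 0 => fun c => ccell c
  | m'.+1 => fun a =>
    match a return two (@pcomp m'.+1 X Y (@psrc m'.+1 X Y a))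
                       (@pcomp m'.+1 X Y (@ptgt m'.+1 X Y a)) with
    | existT Z (c, b) => pcomp2 b \h ccell c
    end
  end.

End Paths.

Section DeformationComplex.
Context {K : fieldType} {C D : linTwoCat K} (F : pseudofunctor C D).

(* F(f_m) \o ... \o F(f_0) *)
Fixpoint Fcomp (m : nat) (X Y : C) : mpath m X Y -> mor (F X) (F Y) :=
  match m with
  | 0 => fun f => F1 F f
  | m'.+1 => fun p => let: existT Z (f, q) := p in Fcomp q \o1 F1 F f
  end.

Lemma Fcomp_unsnoc (m : nat) (X Y : C) (p : mpath m.+1 X Y) :
  F1 F (plast p) \o1 Fcomp (pinit p) = Fcomp p.
Proof.
rewrite /plast /pinit /pmid.
elim: m X Y p => [|m IHm] X Y [Z [f q]] //=.
by move: (IHm _ _ q); case: (unsnoc q) => W [r l] /= <-; exact: comp1A.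
Qed.

Fixpoint Fcomp2 (m : nat) (X Y : C)
  : forall a : path2 m X Y, two (Fcomp (psrc a)) (Fcomp (ptgt a)) :=
  match m with
  | 0 => fun c => F2 F (ccell c)
  | m'.+1 => fun a =>
    match a return two (@Fcomp m'.+1 X Y (psrc (m := m'.+1) a))
                       (@Fcomp m'.+1 X Y (ptgt (m := m'.+1) a)) with
    | existT Z (c, b) => Fcomp2 b \h F2 F (ccell c)
    end
  end.

(* Degrees are shifted by one: the (m+1)-st module X^(m+1)(F) of the complex    *)
(* consists of the [phi : precochain m] with [natural phi].                     *)
Definition precochain (m : nat) : Type :=
  forall (X Y : C) (p : mpath m X Y), two (Fcomp p) (F1 F (pcomp p)).

Definition natural (m : nat) (phi : precochain m) : Prop :=
  forall (X Y : C) (a : path2 m X Y),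
    phi X Y (ptgt a) \v Fcomp2 a = F2 F (pcomp2 a) \v phi X Y (psrc a).

Definition cochain0 (m : nat) : precochain m := fun X Y p => 0.

(* 1 \o Fhat(f_i, f_(i+1)) \o 1, where an empty identity factor is omitted *)
Fixpoint whiskFhat (m i : nat) (X Y : C)
  : forall p : mpath m.+1 X Y, two (Fcomp p) (Fcomp (contract i p)) :=
  match m with
  | 0 => @path_case _ _ 0 X Y
      (fun p => two (Fcomp p) (Fcomp (contract i p)))
      (fun Z f g => Fhat F f g)
  | m'.+1 =>
    match i with
    | 0 => @path_case _ _ m'.+1 X Y
        (fun p => two (Fcomp p) (Fcomp (contract 0 p)))
        (fun Z f => @path_case _ _ m' Z Y
          (fun q => two (Fcomp (pcons f q)) (Fcomp (contract 0 (pcons f q))))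
          (fun W g r => cast2 (comp1A (Fcomp r) (F1 F g) (F1 F f)) erefl
             (id2 (Fcomp r) \h Fhat F f g)))
    | i'.+1 => @path_case _ _ m'.+1 X Y
        (fun p => two (Fcomp p) (Fcomp (contract i'.+1 p)))
        (fun Z f q => whiskFhat i' q \h id2 (F1 F f))
    end
  end.

Definition delta_first (m : nat) (phi : precochain m) (X Y : C)
  : forall p : mpath m.+1 X Y, two (Fcomp p) (F1 F (pcomp p)) :=
  path_case (P := fun p : mpath m.+1 X Y => two (Fcomp p) (F1 F (pcomp p)))
    (fun Z f q => Fhat F f (pcomp q) \v (phi Z Y q \h id2 (F1 F f))).

Definition delta_mid (m : nat) (phi : precochain m) (i : nat) (X Y : C)
  (p : mpath m.+1 X Y) : two (Fcomp p) (F1 F (pcomp p)) :=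
  cast2 erefl (f_equal (@F1 _ _ _ F X Y) (pcomp_contract i p))
    (phi X Y (contract i p) \v whiskFhat i p).

Definition delta_last (m : nat) (phi : precochain m) (X Y : C)
  (p : mpath m.+1 X Y) : two (Fcomp p) (F1 F (pcomp p)) :=
  cast2 (Fcomp_unsnoc p) (f_equal (@F1 _ _ _ F X Y) (pcomp_unsnoc p))
    (Fhat F (pcomp (pinit p)) (plast p)
       \v (id2 (F1 F (plast p)) \h phi X (pmid p) (pinit p))).

(* the coboundary X^(m+1)(F) -> X^(m+2)(F) *)
Definition delta (m : nat) (phi : precochain m) : precochain m.+1 :=
  fun X Y p =>
    delta_first phi p
    + \sum_(i < m.+1) (-1) ^+ i.+1 *: delta_mid phi i p
    + (-1) ^+ m.+2 *: delta_last phi p.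

Definition cocycle (m : nat) (psi : precochain m) : Prop :=
  natural psi /\
  forall (X Y : C) (p : mpath m.+1 X Y), delta psi p = 0.

(* equality of the cohomology classes in H^(m+2)(X(F)) of two cocycles *)
Definition cohomologous (m : nat) (psi psi' : precochain m.+1) : Prop :=
  exists2 phi : precochain m, natural phi &
    forall (X Y : C) (p : mpath m.+1 X Y), psi X Y p - psi' X Y p = delta phi p.

(* an element of degree 3 *)
Definition obstruction (n : nat) (d : ppDeformation F n) : precochain 2 :=
  fun X T =>
  @path_case _ _ 1 X T (fun w => two (Fcomp w) (F1 F (pcomp w))) (fun Y f =>
  @path_case _ _ 0 Y T (fun v => two (Fcomp (pcons f v))
                                     (F1 F (pcomp (pcons f v)))) (fun Z g l =>
    (\sum_(p < n.+1) \sum_(q < n.+1 | (p + q == n.+1)%N)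
       cast2 (comp1A (F1 F l) (F1 F g) (F1 F f))
             (f_equal (@F1 _ _ _ F X T) (comp1A l g f))
         (dhat d p (g \o1 f) l \v (id2 (F1 F l) \h dhat d q f g)))
    - (\sum_(p < n.+1) \sum_(q < n.+1 | (p + q == n.+1)%N)
         (dhat d p f (l \o1 g) \v (dhat d q g l \h id2 (F1 F f)))))).

End DeformationComplex.

(* Main.v *)
(* Write mu = sum_k Fhat^k h^k.  For any formal series mu of families of 2-cells
   F(g) F(f) => F(g f), the associator A = mu (1 mu) - mu (mu 1) satisfies
   mu (A 1) - A (1 1 mu) + A (1 mu 1) - A (mu 1 1) + mu (1 A) = 0,
   because each of the five bracketings of four arrows occurs twice, with opposite
   signs (for the balanced one, by the interchange law).  If A vanishes up to order
   n, then its coefficient of order n+1 is the obstruction Psi, and the coefficient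
   of order n+1 of this identity is delta Psi = 0.  Choosing phi with
   Psi = delta phi as new coefficient of mu kills A in order n+1.  The new unit
   coefficient is phi(id, id): condition (A1) at (id, id, f) reads
   mu(id, f) (1 mu(id, id)) = mu(id, f) (mu(id, f) 1), where mu(id, f) is
   invertible, so 1 mu(id, id) = mu(id, f) 1; when F(id) is an identity this is
   (A2) for mu(id, f).  The other half of (A2) is symmetric. *)
From Stdlib Require Import ProofIrrelevance.
Require Import Defs.
From mathcomp Require Import all_boot all_order all_algebra.
Set Implicit Arguments.
Unset Strict Implicit.
Unset Printing Implicit Defensive.
Import GRing.Theory.
Local Open Scope ring_scope.
Local Open Scope twocat_scope.

(** * Convolution sums: the coefficients of products of formal series *)

Section Convolution.

Definition conv (V : zmodType) (G : nat -> nat -> V) (k : nat) : V :=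
  \sum_(i < k.+1) G i (k - i)%N.

Lemma eq_conv (V : zmodType) (G H : nat -> nat -> V) k :
  (forall i j, (i + j)%N = k -> G i j = H i j) -> conv G k = conv H k.
Proof. by move=> GH; apply: eq_bigr => i _; rewrite GH ?subnKC // -ltnS. Qed.

Lemma conv_sub (V : zmodType) (G H : nat -> nat -> V) k :
  conv (fun i j => G i j - H i j) k = conv G k - conv H k.
Proof. by rewrite /conv sumrB. Qed.

Lemma convC (V : zmodType) (G : nat -> nat -> V) k :
  conv G k = conv (fun i j => G j i) k.
Proof.
rewrite /conv (reindex_inj rev_ord_inj); apply: eq_bigr => i _ /=.
by rewrite subSS subKn // -ltnS.
Qed.

Lemma conv_recl (V : zmodType) (G : nat -> nat -> V) k :
  conv G k.+1 = G 0 k.+1 + conv (fun i j => G i.+1 j) k.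
Proof. by rewrite /conv big_ord_recl. Qed.

Lemma conv_recr (V : zmodType) (G : nat -> nat -> V) k :
  conv G k.+1 = conv (fun i j => G i j.+1) k + G k.+1 0.
Proof. by rewrite convC conv_recl addrC convC. Qed.

Lemma convD (V : zmodType) (G H : nat -> nat -> V) k :
  conv (fun i j => G i j + H i j) k = conv G k + conv H k.
Proof. by rewrite /conv big_split. Qed.

(** Both sides run over all [p + q + r = k]. The induction on [k] peels off the terms with
    [p = 0]. *)
Lemma convA (V : zmodType) (G : nat -> nat -> nat -> V) k :
  conv (fun s r => conv (fun p q => G p q r) s) k =
  conv (fun p s => conv (G p) s) k.
Proof.
elim: k G => [|k IHk] G; first by rewrite /conv !big_ord1.
rewrite conv_recl [RHS]conv_recl -(IHk (fun p => G p.+1)) [in RHS]conv_recl.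
rewrite -addrA -convD {1}/conv big_ord1; congr (_ + _).
by apply: eq_bigr => i _; exact: conv_recl.
Qed.

(** When the second factor starts in order [k], only the constant term of the first one meets it. In
    this way the pentagon identity collapses to a coboundary in its lowest nontrivial order. *)
Lemma conv_lead (V : zmodType) (H : nat -> nat -> V) k :
  (forall i j, (j < k)%N -> H i j = 0) -> conv H k = H 0 k.
Proof.
case: k => [|k] H0; first by rewrite /conv big_ord1.
by rewrite conv_recl /conv big1 ?addr0 // => i _; rewrite H0 // ltnS leq_subr.
Qed.

Lemma conv_tail (V : zmodType) (H : nat -> nat -> V) k :
  (forall i j, (i < k)%N -> H i j = 0) -> conv H k = H k 0.
Proof. by move=> H0; rewrite convC conv_lead // => i j; exact: H0. Qed.

Definition conv3 (V : zmodType) (G : nat -> nat -> nat -> V) (k : nat) : V :=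
  conv (fun s r => conv (fun p q => G p q r) s) k.

Lemma eq_conv3 (V : zmodType) (G H : nat -> nat -> nat -> V) k :
  (forall p q r, G p q r = H p q r) -> conv3 G k = conv3 H k.
Proof. by move=> GH; do 2!apply: eq_conv => *; exact: GH. Qed.

Lemma conv3_swap (V : zmodType) (G : nat -> nat -> nat -> V) k :
  conv3 G k = conv3 (fun p q r => G p r q) k.
Proof. by rewrite /conv3 !convA; apply: eq_conv => i j _; exact: convC. Qed.

Section Linear.
Variables (K : fieldType) (U V : lmodType K) (h : U -> V).
Hypothesis h_lin : linear h.

Lemma lin0 : h 0 = 0.
Proof. by have := h_lin (-1) 0 0; rewrite scaler0 addr0 scaleN1r addNr. Qed.

Lemma linD x y : h (x + y) = h x + h y.
Proof. by have := h_lin 1 x y; rewrite !scale1r. Qed.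

Lemma linB x y : h (x - y) = h x - h y.
Proof. by have := h_lin (-1) y x; rewrite !scaleN1r ![- _ + _]addrC. Qed.

Lemma lin_conv (G : nat -> nat -> U) k :
  h (conv G k) = conv (fun i j => h (G i j)) k.
Proof. exact: (big_morph h linD lin0). Qed.

End Linear.

Section LinearFamily.
Variables (K : fieldType) (U V : lmodType K) (h : nat -> U -> V).
Hypothesis h_lin : forall i, linear (h i).
Variables G H : nat -> nat -> U.

(** Serves to expand a series of linear operators, such as the face maps, applied to the
    coefficients of an associator. *)
Lemma conv_linl k :
  conv (fun i j => h i (conv (fun q r => G q r - H q r) j)) k =
  conv3 (fun p q r => h p (G q r)) k - conv3 (fun p q r => h p (H q r)) k.
Proof.
rewrite /conv3 !convA -conv_sub; apply: eq_conv => i j _.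
by rewrite conv_sub (linB (h_lin i)) !(lin_conv (h_lin i)).
Qed.

Lemma conv_linr k :
  conv (fun i j => h j (conv (fun p q => G p q - H p q) i)) k =
  conv3 (fun p q r => h r (G p q)) k - conv3 (fun p q r => h r (H p q)) k.
Proof.
rewrite /conv3 -conv_sub; apply: eq_conv => i j _.
by rewrite conv_sub (linB (h_lin j)) !(lin_conv (h_lin j)).
Qed.

End LinearFamily.

End Convolution.

(** * Equality of 2-morphisms up to transport of their endpoints *)

Section HeterogeneousEquality.
Context {K : fieldType} {C : linTwoCat K}.

Lemma cast2_irrelevance (X Y : C) (f f' g g' : mor X Y)
  (ef ef' : f = f') (eg eg' : g = g') (a : two f g) :
  cast2 ef eg a = cast2 ef' eg' a.
Proof.
by rewrite (proof_irrelevance _ ef ef') (proof_irrelevance _ eg eg').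
Qed.

Lemma cast2P (X Y : C) (f f' g g' : mor X Y) (ef : f = f') (eg : g = g') :
  linear (@cast2 K C X Y f f' g g' ef eg).
Proof. by case: _ / ef; case: _ / eg. Qed.

Lemma cast2_inj (X Y : C) (f f' g g' : mor X Y) (ef : f = f') (eg : g = g')
  (a b : two f g) : cast2 ef eg a = cast2 ef eg b -> a = b.
Proof. by case: _ / ef; case: _ / eg. Qed.

Lemma vcompPl (X Y : C) (f g h : mor X Y) (b b' : two g h) (a : two f g) k :
  (k *: b + b') \v a = k *: (b \v a) + b' \v a.
Proof. exact: vcomp_linl. Qed.

Lemma vcompPr (X Y : C) (f g h : mor X Y) (b : two g h) (a a' : two f g) k :
  b \v (k *: a + a') = k *: (b \v a) + b \v a'.
Proof. exact: vcomp_linr. Qed.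

Lemma hcompPl (X Y Z : C) (f f' : mor X Y) (g g' : mor Y Z)
  (b b' : two g g') (a : two f f') k :
  (k *: b + b') \h a = k *: (b \h a) + b' \h a.
Proof. exact: hcomp_linl. Qed.

Lemma hcompPr (X Y Z : C) (f f' : mor X Y) (g g' : mor Y Z)
  (b : two g g') (a a' : two f f') k :
  b \h (k *: a + a') = k *: (b \h a) + b \h a'.
Proof. exact: hcomp_linr. Qed.

(* Equality of 2-cells whose endpoints agree only propositionally. *)
Definition heq (X Y : C) (f g f' g' : mor X Y) (a : two f g) (b : two f' g') :=
  exists ef eg, cast2 ef eg a = b.

Local Notation "a =~ b" := (heq a b) (at level 70).

(** When the endpoints already coincide, proof irrelevance makes the transport trivial. *)
Lemma heqP (X Y : C) (f g : mor X Y) (a b : two f g) : a =~ b -> a = b.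
Proof.
by case=> ef [eg <-]; rewrite (cast2_irrelevance ef erefl eg erefl).
Qed.

Lemma heq_refl (X Y : C) (f g : mor X Y) (a : two f g) : a =~ a.
Proof. by exists erefl, erefl. Qed.

Lemma eq_heq (X Y : C) (f g : mor X Y) (a b : two f g) : a = b -> a =~ b.
Proof. by move->; exact: heq_refl. Qed.

Lemma heq_sym (X Y : C) (f g f' g' : mor X Y) (a : two f g) (b : two f' g') :
  a =~ b -> b =~ a.
Proof. by case=> ef [eg <-]; case: _ / ef; case: _ / eg; exact: heq_refl. Qed.

Lemma heq_trans (X Y : C) (f g f' g' f'' g'' : mor X Y) (b : two f' g')
  (a : two f g) (c : two f'' g'') : a =~ b -> b =~ c -> a =~ c.
Proof. by case=> ef [eg <-]; case: _ / ef; case: _ / eg. Qed.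

Lemma heq_cast (X Y : C) (f f' g g' : mor X Y) (ef : f = f') (eg : g = g')
  (a : two f g) : cast2 ef eg a =~ a.
Proof. by apply: heq_sym; exists ef, eg. Qed.

(** Lets a computation forget all casts and restore them only at the end. *)
Lemma cast_heq (X Y : C) (f1 f2 g1 g2 f g : mor X Y)
  (e1 : f1 = f) (e2 : f2 = f) (d1 : g1 = g) (d2 : g2 = g)
  (a : two f1 g1) (b : two f2 g2) : a =~ b -> cast2 e1 d1 a = cast2 e2 d2 b.
Proof.
move=> ab; apply/heqP/(heq_trans (heq_cast _ _ _))/(heq_trans ab).
exact/heq_sym/heq_cast.
Qed.

Lemma heq_vcomp (X Y : C) (f g h f' g' h' : mor X Y)
  (b : two g h) (b' : two g' h') (a : two f g) (a' : two f' g') :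
  b =~ b' -> a =~ a' -> b \v a =~ b' \v a'.
Proof.
case=> eg [eh <-] [ef [eg' <-]]; case: _ / eg eg' => eg'; case: _ / eh.
(* The middle 1-morphisms are identified by two unrelated proofs, one from each factor; the second
   is now a loop and must be replaced by [erefl]. *)
by case: _ / ef; rewrite (cast2_irrelevance _ erefl _ erefl); exact: heq_refl.
Qed.

Lemma heq_hcomp (X Y Z : C) (f g f' g' : mor X Y) (h k h' k' : mor Y Z)
  (b : two h k) (b' : two h' k') (a : two f g) (a' : two f' g') :
  b =~ b' -> a =~ a' -> b \h a =~ b' \h a'.
Proof.
case=> eh [ek <-] [ef [eg <-]].
by case: _ / eh; case: _ / ek; case: _ / ef; case: _ / eg; exact: heq_refl.
Qed.

Lemma heq_hcompA (X Y Z T : C) (f f' : mor X Y) (g g' : mor Y Z)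
  (l l' : mor Z T) (c : two l l') (b : two g g') (a : two f f') :
  c \h (b \h a) =~ (c \h b) \h a.
Proof. by exists (comp1A l g f), (comp1A l' g' f'); exact: hcompA. Qed.

Lemma heq_idl (X Y : C) (f g : mor X Y) (a : two f g) : id2 (id1 Y) \h a =~ a.
Proof. by exists (comp1_idl f), (comp1_idl g); exact: hcomp_idl. Qed.

Lemma heq_idr (X Y : C) (f g : mor X Y) (a : two f g) : a \h id2 (id1 X) =~ a.
Proof. by exists (comp1_idr f), (comp1_idr g); exact: hcomp_idr. Qed.

Lemma hcomp_vcompl (X Y Z : C) (f : mor X Y) (g g' g'' : mor Y Z)
  (b : two g' g'') (a : two g g') :
  (b \v a) \h id2 f = (b \h id2 f) \v (a \h id2 f).
Proof. by rewrite -interchange2 vcomp_idl. Qed.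

Lemma hcomp_vcompr (X Y Z : C) (f f' f'' : mor X Y) (g : mor Y Z)
  (b : two f' f'') (a : two f f') :
  id2 g \h (b \v a) = (id2 g \h b) \v (id2 g \h a).
Proof. by rewrite -interchange2 vcomp_idl. Qed.

(** A formal series with invertible constant term can be cancelled on the left. By strong induction
    the two convolutions in order [k] differ only in the term containing [w 0], which is then
    inverted. *)
Lemma vcomp_cancel (X Y : C) (f g h : mor X Y) (w : nat -> two g h)
  (x y : nat -> two f g) n : is_iso2 (w 0) ->
  (forall k, (k <= n)%N ->
     conv (fun i j => w i \v x j) k = conv (fun i j => w i \v y j) k) ->
  forall k, (k <= n)%N -> x k = y k.
Proof.
case=> w' [w'w _] wxy k; elim/ltn_ind: k => k IHk kn.
have := wxy k kn; suff -> : conv (fun i j => w i \v x j) k =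
  conv (fun i j => w i \v y j) k - w 0%N \v y k + w 0%N \v x k.
  rewrite addrAC => /eqP; rewrite subr_eq => /eqP/addrI.
  by move/(congr1 (fun a => w' \v a)); rewrite !vcompA w'w !vcomp_idl.
case: k IHk kn => [|k] IHk kn; first by rewrite /conv !big_ord1 subrr add0r.
rewrite !conv_recl [w 0%N \v y _ + _]addrC addrK [LHS]addrC; congr (_ + _).
apply: eq_conv => i j ijk; rewrite IHk //.
  by rewrite ltnS -ijk leq_addl.
by rewrite (leq_trans _ kn) // -ijk ltnW // ltnS leq_addl.
Qed.

End HeterogeneousEquality.
Local Notation "a =~ b" := (heq a b) (at level 70).

(** * The associator of a formal series of families and its pentagon identity *)

Section Pentagon.
Context {K : fieldType} {C D : linTwoCat K} (F : pseudofunctor C D).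

Definition family : Type := forall (X Y Z : C) (f : mor X Y) (g : mor Y Z),
  two (F1 F g \o1 F1 F f) (F1 F (g \o1 f)).

Definition natural_family (u : family) : Prop :=
  forall (X Y Z : C) (f f' : mor X Y) (g g' : mor Y Z)
    (a : two f f') (b : two g g'),
  u X Y Z f' g' \v (F2 F b \h F2 F a) = F2 F (b \h a) \v u X Y Z f g.

Section Triples.
Context {X Y Z T : C} (f : mor X Y) (g : mor Y Z) (l : mor Z T).

(** One side of (A1), with separate outer and inner families because a coefficient of a product of
    series mixes different orders. *)
Definition assocl (u v : family) :
  two ((F1 F l \o1 F1 F g) \o1 F1 F f) (F1 F ((l \o1 g) \o1 f)) :=
  cast2 (comp1A (F1 F l) (F1 F g) (F1 F f))
        (f_equal (@F1 _ _ _ F X T) (comp1A l g f))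
    (u _ _ _ (g \o1 f) l \v (id2 (F1 F l) \h v _ _ _ f g)).

Definition assocr (u v : family) :
  two ((F1 F l \o1 F1 F g) \o1 F1 F f) (F1 F ((l \o1 g) \o1 f)) :=
  u _ _ _ f (l \o1 g) \v (v _ _ _ g l \h id2 (F1 F f)).

Definition associator (mu : nat -> family) (k : nat) :=
  conv (fun i j => assocl (mu i) (mu j) - assocr (mu i) (mu j)) k.

Lemma heq_assocl (u v : family) :
  assocl u v =~ u _ _ _ (g \o1 f) l \v (id2 (F1 F l) \h v _ _ _ f g).
Proof. exact: heq_cast. Qed.

End Triples.

Lemma heq_family (u : family) (X Y Z : C) (f f' : mor X Y) (g g' : mor Y Z) :
  f = f' -> g = g' -> u _ _ _ f g =~ u _ _ _ f' g'.
Proof. by move=> -> ->; exact: heq_refl. Qed.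

(* The maps face_* are the five summands of the coboundary of a 3-cochain at the
   path (f0, f1, f2, f3), with an arbitrary family in place of Fhat. *)
Section Quadruples.
Context {X0 X1 X2 X3 X4 : C}.
Context (f0 : mor X0 X1) (f1 : mor X1 X2) (f2 : mor X2 X3) (f3 : mor X3 X4).
Local Notation "1_ f" := (id2 (F1 F f)) (at level 9, f at level 9).
Local Notation S4 := (((F1 F f3 \o1 F1 F f2) \o1 F1 F f1) \o1 F1 F f0).
Local Notation T4 := (F1 F (((f3 \o1 f2) \o1 f1) \o1 f0)).
Local Notation face f g l :=
  (two ((F1 F l \o1 F1 F g) \o1 F1 F f) (F1 F ((l \o1 g) \o1 f))).

Definition face_first (u : family) (x : face f1 f2 f3) : two S4 T4 :=
  u _ _ _ f0 ((f3 \o1 f2) \o1 f1) \v (x \h 1_ f0).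

Definition face_mid0 (w : family) (x : face (f1 \o1 f0) f2 f3) : two S4 T4 :=
  cast2 erefl (f_equal (@F1 _ _ _ F X0 X4) (comp1A (f3 \o1 f2) f1 f0))
    (x \v cast2 (comp1A (F1 F f3 \o1 F1 F f2) (F1 F f1) (F1 F f0)) erefl
            (id2 (F1 F f3 \o1 F1 F f2) \h w _ _ _ f0 f1)).

Definition face_mid1 (w : family) (x : face f0 (f2 \o1 f1) f3) : two S4 T4 :=
  cast2 erefl
    (f_equal (fun h => F1 F (h \o1 f0)) (comp1A f3 f2 f1))
    (x \v (cast2 (comp1A (F1 F f3) (F1 F f2) (F1 F f1)) erefl
             (1_ f3 \h w _ _ _ f1 f2) \h 1_ f0)).

Definition face_mid2 (w : family) (x : face f0 f1 (f3 \o1 f2)) : two S4 T4 :=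
  x \v ((w _ _ _ f2 f3 \h 1_ f1) \h 1_ f0).

Lemma last_src :
  F1 F f3 \o1 ((F1 F f2 \o1 F1 F f1) \o1 F1 F f0) = S4.
Proof. by rewrite !comp1A. Qed.

Lemma last_tgt :
  F1 F (f3 \o1 ((f2 \o1 f1) \o1 f0)) = T4.
Proof. by rewrite !comp1A. Qed.

Definition face_last (u : family) (x : face f0 f1 f2) : two S4 T4 :=
  cast2 last_src last_tgt
    (u _ _ _ ((f2 \o1 f1) \o1 f0) f3 \v (1_ f3 \h x)).

Lemma face_firstP u : linear (face_first u).
Proof. by move=> k x y; rewrite /face_first hcompPl vcompPr. Qed.

Lemma face_mid0P w : linear (face_mid0 w).
Proof. by move=> k x y; rewrite /face_mid0 vcompPl cast2P. Qed.

Lemma face_mid1P w : linear (face_mid1 w).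
Proof. by move=> k x y; rewrite /face_mid1 vcompPl cast2P. Qed.

Lemma face_mid2P w : linear (face_mid2 w).
Proof. by move=> k x y; rewrite /face_mid2 vcompPl. Qed.

Lemma face_lastP u : linear (face_last u).
Proof. by move=> k x y; rewrite /face_last hcompPr vcompPr cast2P. Qed.

(** This and the next four lemmas pair the ten halves of the faces by bracketing of the four arrows:
    in order, [f3 (f2 (f1 f0))], [f3 ((f2 f1) f0)], [(f3 (f2 f1)) f0], [((f3 f2) f1) f0] and the
    balanced [(f3 f2) (f1 f0)]. *)
Lemma face_mid0_assocl u v w :
  face_mid0 w (assocl (f1 \o1 f0) f2 f3 u v) =
  face_last u (assocl f0 f1 f2 v w).
Proof.
apply: cast_heq.
apply: (@heq_trans _ _ _ _ _ _ _ _ _ _ ((u _ _ _ (f2 \o1 (f1 \o1 f0)) f3 \v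
   (1_ f3 \h v _ _ _ (f1 \o1 f0) f2)) \v (1_ f3 \h (1_ f2 \h w _ _ _ f0 f1)))).
  apply: heq_vcomp (heq_assocl _ _ _ u v) (heq_trans (heq_cast _ _ _) _).
  by rewrite -hcomp_id2; exact/heq_sym/heq_hcompA.
rewrite -vcompA -hcomp_vcompr; apply: heq_vcomp.
  by apply: heq_family => //; exact: comp1A.
apply: heq_hcomp (heq_refl _) _; exact/heq_sym/heq_assocl.
Qed.

Lemma face_mid1_assocl u v w :
  face_mid1 w (assocl f0 (f2 \o1 f1) f3 u v) =
  face_last u (assocr f0 f1 f2 v w).
Proof.
apply: cast_heq.
apply: (@heq_trans _ _ _ _ _ _ _ _ _ _ ((u _ _ _ ((f2 \o1 f1) \o1 f0) f3 \v
   (1_ f3 \h v _ _ _ f0 (f2 \o1 f1))) \v (1_ f3 \h (w _ _ _ f1 f2 \h 1_ f0)))).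
  apply: heq_vcomp (heq_assocl _ _ _ u v) _.
  apply: heq_trans (heq_hcomp (heq_cast _ _ _) (heq_refl _)) _.
  exact/heq_sym/heq_hcompA.
by rewrite /assocr hcomp_vcompr vcompA; exact: heq_refl.
Qed.

Lemma face_mid1_assocr u v w :
  face_mid1 w (assocr f0 (f2 \o1 f1) f3 u v) =
  face_first u (assocl f1 f2 f3 v w).
Proof.
apply/heqP/(heq_trans (heq_cast _ _ _)); rewrite /assocr -vcompA.
rewrite -hcomp_vcompl; apply: heq_vcomp.
  by apply: heq_family => //; exact: comp1A.
apply: heq_hcomp (heq_refl _); apply/heq_sym/(heq_trans (heq_assocl _ _ _ v w)).
by apply: heq_vcomp (heq_refl _) _; exact/heq_sym/heq_cast.
Qed.

Lemma face_mid2_assocr u v w :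
  face_mid2 w (assocr f0 f1 (f3 \o1 f2) u v) =
  face_first u (assocr f1 f2 f3 v w).
Proof. by rewrite /face_mid2 /face_first /assocr -vcompA -hcomp_vcompl. Qed.

(** The balanced bracketing: [v] and [w] act on disjoint pairs of arrows, so by interchange either
    may come first. Hence they trade places between the two sides. *)
Lemma face_mid2_assocl u v w :
  face_mid2 w (assocl f0 f1 (f3 \o1 f2) u v) =
  face_mid0 v (assocr (f1 \o1 f0) f2 f3 u w).
Proof.
apply/heqP/heq_sym/(heq_trans (heq_cast _ _ _)); rewrite /assocr.
apply: (@heq_trans _ _ _ _ _ _ _ _ _ _
          (u _ _ _ (f1 \o1 f0) (f3 \o1 f2) \v (w _ _ _ f2 f3 \h v _ _ _ f0 f1))).
  rewrite -vcompA; apply: heq_vcomp (heq_refl _) _.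
  rewrite -[in X in _ =~ X](vcomp_idr (w _ _ _ f2 f3)).
  rewrite -[in X in _ =~ X](vcomp_idl (v _ _ _ f0 f1)) interchange2.
  by apply: heq_vcomp (heq_refl _) _; exact: heq_cast.
rewrite -[in X in X =~ _](vcomp_idl (w _ _ _ f2 f3)).
rewrite -[in X in X =~ _](vcomp_idr (v _ _ _ f0 f1)) interchange2 vcompA.
apply: heq_vcomp; first exact/heq_sym/heq_assocl.
by rewrite -hcomp_id2; exact: heq_hcompA.
Qed.

Lemma pentagon (mu : nat -> family) (k : nat) :
  conv (fun i j => face_first (mu i) (associator f1 f2 f3 mu j)) k
  - conv (fun i j => face_mid0 (mu j) (associator (f1 \o1 f0) f2 f3 mu i)) k
  + conv (fun i j => face_mid1 (mu j) (associator f0 (f2 \o1 f1) f3 mu i)) k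
  - conv (fun i j => face_mid2 (mu j) (associator f0 f1 (f3 \o1 f2) mu i)) k
  + conv (fun i j => face_last (mu i) (associator f0 f1 f2 mu j)) k = 0.
Proof.
rewrite /associator (conv_linl (fun i => face_firstP (mu i))).
rewrite (conv_linr (fun j => face_mid0P (mu j))).
rewrite (conv_linr (fun j => face_mid1P (mu j))).
rewrite (conv_linr (fun j => face_mid2P (mu j))).
rewrite (conv_linl (fun i => face_lastP (mu i))).
rewrite (eq_conv3 _ (fun p q r => face_mid0_assocl (mu p) (mu q) (mu r))).
rewrite (eq_conv3 _ (fun p q r => face_mid1_assocl (mu p) (mu q) (mu r))).
rewrite (eq_conv3 _ (fun p q r => face_mid1_assocr (mu p) (mu q) (mu r))).
rewrite (eq_conv3 _ (fun p q r => face_mid2_assocl (mu p) (mu q) (mu r))).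
rewrite (eq_conv3 _ (fun p q r => face_mid2_assocr (mu p) (mu q) (mu r))).
(* The interchange law has exchanged the last two factors; renaming the summation indices restores
   their order. *)
rewrite [conv3 (fun p q r => face_mid0 (mu q) _) k]conv3_swap !opprB.
(* Equal terms with opposite signs stand five places apart. *)
rewrite (AC (2*2*2*2*2) ((1*6)*(2*7)*(3*8)*(4*9)*(5*10))) /=.
by rewrite !subrr !addNr !addr0.
Qed.

End Quadruples.
End Pentagon.

Arguments face_first {K C D F X0 X1 X2 X3 X4} f0 f1 f2 f3 u x.
Arguments face_mid0 {K C D F X0 X1 X2 X3 X4} f0 f1 f2 f3 w x.
Arguments face_mid1 {K C D F X0 X1 X2 X3 X4} f0 f1 f2 f3 w x.
Arguments face_mid2 {K C D F X0 X1 X2 X3 X4} f0 f1 f2 f3 w x.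
Arguments face_last {K C D F X0 X1 X2 X3 X4} f0 f1 f2 f3 u x.
Arguments face_firstP {K C D F X0 X1 X2 X3 X4} f0 f1 f2 f3 u _ _ _.
Arguments face_mid0P {K C D F X0 X1 X2 X3 X4} f0 f1 f2 f3 w _ _ _.
Arguments face_mid1P {K C D F X0 X1 X2 X3 X4} f0 f1 f2 f3 w _ _ _.
Arguments face_mid2P {K C D F X0 X1 X2 X3 X4} f0 f1 f2 f3 w _ _ _.
Arguments face_lastP {K C D F X0 X1 X2 X3 X4} f0 f1 f2 f3 u _ _ _.

(** * The coboundary in low degrees *)

Section Deformation.
Context {K : fieldType} {C D : linTwoCat K} (F : pseudofunctor C D).

Local Notation path3 f g l := (pcons f (@pcons K C 0 _ _ _ g l)).

Definition family_cochain (phi : precochain F 1) : family F :=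
  fun X Y Z f g => phi X Z (@pcons K C 0 X Y Z f g).

(** This is minus the linear part of the associator at [Fhat] in the direction [phi], so a new top
    coefficient [phi] contributes [- delta phi] to the associator. *)
Lemma delta_triple (phi : precochain F 1) (X Y Z T : C)
  (f : mor X Y) (g : mor Y Z) (l : mor Z T) :
  delta phi (path3 f g l) =
  assocr f g l (@Fhat _ _ _ F) (family_cochain phi)
  - assocl f g l (family_cochain phi) (@Fhat _ _ _ F)
  + assocr f g l (family_cochain phi) (@Fhat _ _ _ F)
  - assocl f g l (@Fhat _ _ _ F) (family_cochain phi).
Proof.
rewrite /delta big_ord_recl big_ord1 /= /bump /= expr1 sqrrN expr1n.
rewrite scale1r !scaleN1r -[(-1) ^+ 3]signr_odd /= expr1 scaleN1r addrA.
congr (_ - _ + _ - _).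
- apply: cast_heq; apply: heq_vcomp (heq_refl _) (heq_cast _ _ _).
- apply/heqP/heq_cast.
- apply: cast_heq; apply: heq_refl.
Qed.

Lemma delta_quadruple (psi : precochain F 2) (X0 X1 X2 X3 X4 : C)
  (f0 : mor X0 X1) (f1 : mor X1 X2) (f2 : mor X2 X3) (f3 : mor X3 X4) :
  delta psi (pcons f0 (@pcons K C 1 _ _ _ f1 (@pcons K C 0 _ _ _ f2 f3))) =
  face_first f0 f1 f2 f3 (@Fhat _ _ _ F) (psi _ _ (path3 f1 f2 f3))
  - face_mid0 f0 f1 f2 f3 (@Fhat _ _ _ F) (psi _ _ (path3 (f1 \o1 f0) f2 f3))
  + face_mid1 f0 f1 f2 f3 (@Fhat _ _ _ F) (psi _ _ (path3 f0 (f2 \o1 f1) f3))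
  - face_mid2 f0 f1 f2 f3 (@Fhat _ _ _ F) (psi _ _ (path3 f0 f1 (f3 \o1 f2)))
  + face_last f0 f1 f2 f3 (@Fhat _ _ _ F) (psi _ _ (path3 f0 f1 f2)).
Proof.
rewrite /delta !big_ord_recl big_ord0 /= /bump /= addr0.
rewrite -[(-1) ^+ 3]signr_odd -[(-1) ^+ 4]signr_odd -[(-1) ^+ 2]signr_odd.
rewrite /= !expr1 !scaleN1r !scale1r !addrA.
congr (_ - _ + _ - _ + _).
- apply: cast_heq; apply: heq_refl.
- apply: cast_heq; apply: heq_refl.
- apply/heqP/heq_cast.
- apply: cast_heq; apply: heq_refl.
Qed.


(** * The obstruction as part of a coefficient of the associator *)

Lemma sum_offdiagonal (V : zmodType) (G : nat -> nat -> V) n :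
  \sum_(p < n.+2) \sum_(q < n.+2 | (p + q == n.+2)%N) G p q =
  conv (fun i j => G i.+1 j.+1) n.
Proof.
(* The row [p = 0] is empty, since it would require [q = n.+2]; each other row has exactly one
   admissible [q]. *)
rewrite big_ord_recl big1 ?add0r => [|q /eqP qE]; last first.
  by have := ltn_ord q; rewrite -[X in (_ < X)%N]qE ltnn.
apply: eq_bigr => i _; have lt_in : ((n - i).+1 < n.+2)%N.
  by rewrite !ltnS leq_subr.
rewrite (big_pred1 (Ordinal lt_in)) //= => q.
rewrite /bump /= add1n addSn eqSS -val_eqE /= -(eqn_add2l i q) addnS.
by rewrite subnKC // -ltnS.
Qed.

Definition dhat_family n (d : ppDeformation F n) (k : nat) : family F :=
  @dhat _ _ _ _ _ d k.

(** For a deformation of order [n.+1] the obstruction lives in order [n.+2] with both indices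
    positive; shifting each by one leaves a convolution of order [n]. *)
Lemma obstruction_triple n (d : ppDeformation F n.+1) (X Y Z T : C)
  (f : mor X Y) (g : mor Y Z) (l : mor Z T) :
  obstruction d (path3 f g l) =
  conv (fun i j => assocl f g l (dhat_family d i.+1) (dhat_family d j.+1)
                   - assocr f g l (dhat_family d i.+1) (dhat_family d j.+1)) n.
Proof.
rewrite conv_sub -[X in X - _](sum_offdiagonal (fun p q =>
  assocl f g l (dhat_family d p) (dhat_family d q))).
by rewrite -(sum_offdiagonal (fun p q =>
  assocr f g l (dhat_family d p) (dhat_family d q))).
Qed.

(** Separates the terms containing the coefficient [mu n.+2] from those built from orders [1] to
    [n.+1] only. *)
Lemma associator_top (mu : nat -> family F) n (X Y Z T : C)
  (f : mor X Y) (g : mor Y Z) (l : mor Z T) :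
  associator f g l mu n.+2 =
  (assocl f g l (mu 0) (mu n.+2) - assocr f g l (mu 0) (mu n.+2))
  + (conv (fun i j => assocl f g l (mu i.+1) (mu j.+1)
                      - assocr f g l (mu i.+1) (mu j.+1)) n
    + (assocl f g l (mu n.+2) (mu 0) - assocr f g l (mu n.+2) (mu 0))).
Proof. by rewrite /associator conv_recl conv_recr. Qed.

Lemma hhcomp_constl (E : linTwoCat K) (X Y Z : E) (f f' : mor X Y)
  (g g' : mor Y Z) (b : two g g') (a : hcell f f') k :
  hhcomp (hconst b) a k = b \h a k.
Proof.
rewrite /hhcomp big_ord_recl /= subn0 big1 ?addr0 // => i _.
exact: (lin0 (@hcomp_linl K E _ _ _ _ _ _ _ _)).
Qed.

Lemma hhcomp_constr (E : linTwoCat K) (X Y Z : E) (f f' : mor X Y)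
  (g g' : mor Y Z) (b : hcell g g') (a : two f f') k :
  hhcomp b (hconst a) k = b k \h a.
Proof.
rewrite /hhcomp big_ord_recr /= subnn big1 ?add0r // => i _.
rewrite /hconst subn_eq0 leqNgt ltn_ord.
exact: (lin0 (@hcomp_linr K E _ _ _ _ _ _ _ _)).
Qed.

Lemma hvcompE (E : linTwoCat K) (X Y : E) (f g h : mor X Y)
  (b : hcell g h) (a : hcell f g) k :
  hvcomp b a k = conv (fun i j => b i \v a j) k.
Proof. by []. Qed.

(** In order [k] only coefficients of order at most [k] occur, so truncation above [n] is
    invisible. *)
Lemma A1_associator n (mu : nat -> family F) (X Y Z T : C)
  (f : mor X Y) (g : mor Y Z) (l : mor Z T) k : (k <= n)%N ->
  (hcast (comp1A (F1 F l) (F1 F g) (F1 F f))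
         (f_equal (@F1 _ _ _ F X T) (comp1A l g f))
    (hvcomp (htrunc n (fun k => mu k _ _ _ (g \o1 f) l))
       (hhcomp (hconst (id2 (F1 F l))) (htrunc n (fun k => mu k _ _ _ f g)))) k
   = hvcomp (htrunc n (fun k => mu k _ _ _ f (l \o1 g)))
       (hhcomp (htrunc n (fun k => mu k _ _ _ g l)) (hconst (id2 (F1 F f)))) k)
  <-> associator f g l mu k = 0.
Proof.
move=> le_kn; rewrite /associator conv_sub.
set lhs := hcast _ _ _ _; set rhs := hvcomp _ _ _.
have -> : lhs = conv (fun i j => assocl f g l (mu i) (mu j)) k.
  rewrite /lhs /hcast hvcompE (lin_conv (@cast2P _ _ _ _ _ _ _ _ _ _)).
  apply: eq_conv => i j ijk; rewrite hhcomp_constl /htrunc.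
  by rewrite !(leq_trans _ le_kn) // -ijk ?leq_addr ?leq_addl.
have -> : rhs = conv (fun i j => assocr f g l (mu i) (mu j)) k.
  rewrite /rhs hvcompE; apply: eq_conv => i j ijk; rewrite hhcomp_constr /htrunc.
  by rewrite !(leq_trans _ le_kn) // -ijk ?leq_addr ?leq_addl.
by split=> [->|/eqP]; rewrite ?subrr // subr_eq0 => /eqP.
Qed.

(** * Naturality of the obstruction *)

Lemma heq_F2 (X Y : C) (f g f' g' : mor X Y) (a : two f g) (b : two f' g') :
  a =~ b -> F2 F a =~ F2 F b.
Proof. by case=> ef [eg <-]; case: _ / ef; case: _ / eg; exact: heq_refl. Qed.

Section Naturality.
Context {X Y Z T : C} {f f' : mor X Y} {g g' : mor Y Z} {l l' : mor Z T}.
Variables (a : two f f') (b : two g g') (c : two l l') (u v : family F).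
Hypotheses (u_nat : natural_family u) (v_nat : natural_family v).

Lemma assocr_natural :
  assocr f' g' l' u v \v ((F2 F c \h F2 F b) \h F2 F a) =
  F2 F ((c \h b) \h a) \v assocr f g l u v.
Proof.
rewrite /assocr -vcompA -interchange2 v_nat vcomp_idl -[F2 F a]vcomp_idr.
by rewrite interchange2 !vcompA u_nat.
Qed.

Lemma assocl_natural :
  assocl f' g' l' u v \v ((F2 F c \h F2 F b) \h F2 F a) =
  F2 F ((c \h b) \h a) \v assocl f g l u v.
Proof.
apply: heqP; apply: (@heq_trans _ _ _ _ _ _ _ _ _ _
  (F2 F (c \h (b \h a)) \v (u (g \o1 f) l \v (id2 (F1 F l) \h v f g)))).
  apply: (heq_trans (heq_vcomp (heq_assocl f' g' l' u v)
            (heq_sym (heq_hcompA (F2 F c) (F2 F b) (F2 F a))))).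
  apply: eq_heq; rewrite -vcompA -interchange2 v_nat vcomp_idl.
  by rewrite -[F2 F c]vcomp_idr interchange2 !vcompA u_nat.
apply: heq_vcomp; last exact/heq_sym/heq_assocl.
exact/heq_F2/heq_hcompA.
Qed.

End Naturality.

Lemma dhat_natural_family n (d : ppDeformation F n) k :
  (k <= n)%N -> natural_family (dhat_family d k).
Proof.
(* In order 0 naturality comes from the pseudofunctor itself. *)
case: k => [_|k kn] X Y Z f f' g g' a b; last exact: dhat_natural.
by rewrite /dhat_family !dhat0; exact: Fhat_natural.
Qed.

Lemma obstruction_natural n (d : ppDeformation F n.+1) :
  natural (obstruction d).
Proof.
move=> X T [Y [[f [f' a]] [Z [[g [g' b]] [l [l' c]]]]]].
have := obstruction_triple d f g l; have := obstruction_triple d f' g' l'.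
rewrite /pcons /= => -> ->; rewrite /ccell /=.
rewrite (lin_conv (@vcomp_linl K _ _ _ _ _ _ _)).
rewrite (lin_conv (@vcomp_linr K _ _ _ _ _ _ _)).
apply: eq_conv => i j ijn.
rewrite (linB (@vcomp_linl K _ _ _ _ _ _ _)).
rewrite (linB (@vcomp_linr K _ _ _ _ _ _ _)).
have ui : natural_family (dhat_family d i.+1).
  by apply: dhat_natural_family; rewrite ltnS -ijn leq_addr.
have uj : natural_family (dhat_family d j.+1).
  by apply: dhat_natural_family; rewrite ltnS -ijn leq_addl.
by rewrite (assocl_natural a b c ui uj) (assocr_natural a b c ui uj).
Qed.

(** * Adding one coefficient to a deformation, and the cocycle condition *)

Lemma eq_associator (mu nu : nat -> family F) (X Y Z T : C)
  (f : mor X Y) (g : mor Y Z) (l : mor Z T) k :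
  (forall i, (i <= k)%N -> forall (X Y Z : C) (f : mor X Y) (g : mor Y Z),
     mu i _ _ _ f g = nu i _ _ _ f g) ->
  associator f g l mu k = associator f g l nu k.
Proof.
move=> eq_mu; apply: eq_conv => i j ijk.
by rewrite /assocl /assocr !eq_mu // -ijk ?leq_addr ?leq_addl.
Qed.

(** Order 0 is [Fhat] rather than [dhat d 0], which agrees with it only pointwise; thus the constant
    term is [Fhat] by computation. *)
Definition extend_family n (d : ppDeformation F n) (phi : family F) (k : nat)
  : family F :=
  if k is k'.+1 then if (k <= n)%N then dhat_family d k else phi else @Fhat _ _ _ F.

Lemma extend_familyE n (d : ppDeformation F n) phi k : (k <= n)%N ->
  forall (X Y Z : C) (f : mor X Y) (g : mor Y Z),
    extend_family d phi k f g = dhat d k f g.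
Proof. by case: k => [|k] kn *; rewrite /extend_family ?dhat0 // kn. Qed.

Lemma extend_family_top n (d : ppDeformation F n) phi :
  extend_family d phi n.+1 = phi.
Proof. by rewrite /extend_family ltnn. Qed.

Lemma extend_family_natural n (d : ppDeformation F n) phi k :
  natural_family phi -> (k <= n.+1)%N -> natural_family (extend_family d phi k).
Proof.
move=> phi_nat; rewrite leq_eqVlt => /predU1P[->|].
  by rewrite extend_family_top.
rewrite ltnS => kn X Y Z f f' g g' a b; rewrite !extend_familyE //.
exact: dhat_natural_family.
Qed.

Lemma extend_family_associator n (d : ppDeformation F n) phi (X Y Z T : C)
  (f : mor X Y) (g : mor Y Z) (l : mor Z T) k : (k <= n)%N ->
  associator f g l (extend_family d phi) k = 0.
Proof.
move=> kn; rewrite (eq_associator (nu := dhat_family d)) => [|i ik *].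
  by apply/(A1_associator (dhat_family d) f g l kn); exact: dhat_A1.
by rewrite extend_familyE // (leq_trans ik).
Qed.

(** The terms free of [phi] form the obstruction, and those containing [phi] form [- delta phi]. *)
Lemma extend_family_associator_top n (d : ppDeformation F n.+1)
  (phi : precochain F 1) (X Y Z T : C)
  (f : mor X Y) (g : mor Y Z) (l : mor Z T) :
  associator f g l (extend_family d (family_cochain phi)) n.+2 =
  obstruction d (path3 f g l)
  - delta phi (path3 f g l).
Proof.
rewrite associator_top delta_triple obstruction_triple extend_family_top.
rewrite [extend_family _ _ 0]/=.
set Psi := conv _ n; set Psi' := conv _ n.
have -> : Psi = Psi'.
  apply: eq_conv => i j ijn; have [le_in le_jn] : (i <= n)%N /\ (j <= n)%N.
    by rewrite -ijn leq_addr leq_addl.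
  by rewrite /extend_family !ltnS le_in le_jn.
rewrite !opprD !opprK [LHS]addrC -[LHS]addrA; congr (_ + _).
by rewrite (AC (2*2) (4*1*2*3)).
Qed.

Lemma delta_cochain0 (X Y Z T : C) (f : mor X Y) (g : mor Y Z) (l : mor Z T) :
  delta (cochain0 F (m := 1)) (path3 f g l) = 0.
Proof.
rewrite delta_triple /assocl /assocr /family_cochain /cochain0.
rewrite (lin0 (@hcomp_linl K D _ _ _ _ _ _ _ _)).
rewrite (lin0 (@hcomp_linr K D _ _ _ _ _ _ _ _)).
rewrite !(lin0 (@vcomp_linl K D _ _ _ _ _ _)).
rewrite !(lin0 (@vcomp_linr K D _ _ _ _ _ _)).
by rewrite !(lin0 (@cast2P _ _ _ _ _ _ _ _ _ _)) !subr0 addr0.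
Qed.

Lemma obstruction_cocycle n (d : ppDeformation F n.+1) :
  cocycle (obstruction d).
Proof.
split; first exact: obstruction_natural.
move=> X0 X4 [X1 [f0 [X2 [f1 [X3 [f2 f3]]]]]].
rewrite (delta_quadruple _ f0 f1 f2 f3).
(* Extending by zero makes the obstruction the top coefficient of an associator, to which the
   pentagon identity applies. *)
pose mu := extend_family d (family_cochain (@cochain0 _ _ _ F 1)).
have muE X Y Z T (f : mor X Y) (g : mor Y Z) (l : mor Z T) :
    obstruction d (path3 f g l) = associator f g l mu n.+2.
  by rewrite extend_family_associator_top delta_cochain0 subr0.
have mu0 X Y Z T (f : mor X Y) (g : mor Y Z) (l : mor Z T) k :
    (k < n.+2)%N -> associator f g l mu k = 0.
  by rewrite ltnS; exact: extend_family_associator.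
rewrite !muE -[RHS](pentagon f0 f1 f2 f3 mu n.+2).
(* The associator vanishes below order [n.+2], so each of the five convolutions keeps only its term
   with [mu 0], that is [Fhat]. *)
rewrite conv_lead => [|i j jn]; last by
  rewrite mu0 // (lin0 (face_firstP _ _ _ _ _)).
rewrite conv_tail => [|i j jn]; last by
  rewrite mu0 // (lin0 (face_mid0P _ _ _ _ _)).
rewrite conv_tail => [|i j jn]; last by
  rewrite mu0 // (lin0 (face_mid1P _ _ _ _ _)).
rewrite conv_tail => [|i j jn]; last by
  rewrite mu0 // (lin0 (face_mid2P _ _ _ _ _)).
by rewrite conv_lead => [|i j jn]; last by
  rewrite mu0 // (lin0 (face_lastP _ _ _ _ _)).
Qed.

(** * The unit conditions and the extended deformation *)

Hypothesis hF : unitary F.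

Lemma unitary_id1 (X : C) : F1 F (id1 X) = id1 (F X).
Proof. by case: (hF X). Qed.

Section Units.
Variables (mu : nat -> family F) (n : nat).
Hypothesis mu0 : mu 0 = @Fhat _ _ _ F.
Hypothesis muA :
  forall (X Y Z T : C) (f : mor X Y) (g : mor Y Z) (l : mor Z T) k,
  (k <= n)%N -> associator f g l mu k = 0.

(** In (A1) at [(id, id, f)] both sides start with the series [mu (id, f)], whose constant term is
    invertible; [vcomp_cancel] removes it. *)
Lemma heq_unitr (X Y : C) (f : mor X Y) k : (k <= n)%N ->
  mu k (id1 X) f =~ id2 (F1 F f) \h mu k (id1 X) (id1 X).
Proof.
move=> kn.
(* [M] is the source of every [w i]; the inner factors of both sides of (A1) are transported to end
   there. *)
pose M := F1 F f \o1 F1 F (id1 X).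
have ex : F1 F f \o1 F1 F (id1 X \o1 id1 X) = M by rewrite comp1_idr.
have ey : F1 F (f \o1 id1 X) \o1 F1 F (id1 X) = M by rewrite comp1_idr.
pose w i := mu i (id1 X) f.
pose x j := cast2 (comp1A _ _ _) ex (id2 (F1 F f) \h mu j (id1 X) (id1 X)).
pose y j := cast2 erefl ey (mu j (id1 X) f \h id2 (F1 F (id1 X))).
have et : F1 F (f \o1 id1 X) = F1 F ((f \o1 id1 X) \o1 id1 X).
  by rewrite !comp1_idr.
have wE i j :
    cast2 erefl et (w i \v x j) =
    assocl (id1 X) (id1 X) f (mu i) (mu j).
  apply: cast_heq; apply: heq_vcomp (heq_cast _ _ _).
  by apply: (heq_family (mu i)) => //; rewrite comp1_idr.
have wE' i j :
    cast2 erefl et (w i \v y j) =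
    assocr (id1 X) (id1 X) f (mu i) (mu j).
  apply/heqP/(heq_trans (heq_cast _ _ _)); apply: heq_vcomp (heq_cast _ _ _).
  by apply: (heq_family (mu i)) => //; rewrite comp1_idr.
have xy : x k = y k.
  apply: (vcomp_cancel (w := w) (n := n)) => // [|{kn}k kn].
    by rewrite /w mu0; exact: Fhat_iso.
  apply: (@cast2_inj _ _ _ _ _ _ _ _ erefl et); apply/eqP.
  rewrite -subr_eq0 !(lin_conv (@cast2P _ _ _ _ _ _ _ _ _ _)) -conv_sub.
  apply/eqP; rewrite -(muA (id1 X) (id1 X) f kn).
  by apply: eq_conv => i j _; rewrite wE wE'.
(* Unitarity enters here: whiskering with [F(id) = id] changes nothing. *)
apply: heq_trans (heq_sym (heq_idr _)) _; rewrite -unitary_id1.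
apply: heq_trans (heq_sym (heq_cast erefl ey _)) _.
apply: heq_trans (eq_heq (esym xy)) _; exact: heq_cast.
Qed.

(** The mirror image: (A1) at [(f, id, id)], cancelling the series [mu (f, id)]. *)
Lemma heq_unitl (X Y : C) (f : mor X Y) k : (k <= n)%N ->
  mu k f (id1 Y) =~ mu k (id1 Y) (id1 Y) \h id2 (F1 F f).
Proof.
move=> kn.
pose M := F1 F (id1 Y) \o1 F1 F f.
have ex : F1 F (id1 Y) \o1 F1 F (id1 Y \o1 f) = M by rewrite comp1_idl.
have ey : F1 F (id1 Y \o1 id1 Y) \o1 F1 F f = M by rewrite comp1_idl.
pose w i := mu i f (id1 Y).
pose x j := cast2 (comp1A _ _ _) ex (id2 (F1 F (id1 Y)) \h mu j f (id1 Y)).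
pose y j := cast2 erefl ey (mu j (id1 Y) (id1 Y) \h id2 (F1 F f)).
have et : F1 F (id1 Y \o1 f) = F1 F ((id1 Y \o1 id1 Y) \o1 f).
  by rewrite !comp1_idl.
have wE i j :
    cast2 erefl et (w i \v x j) =
    assocl f (id1 Y) (id1 Y) (mu i) (mu j).
  apply: cast_heq; apply: heq_vcomp (heq_cast _ _ _).
  by apply: (heq_family (mu i)) => //; rewrite comp1_idl.
have wE' i j :
    cast2 erefl et (w i \v y j) =
    assocr f (id1 Y) (id1 Y) (mu i) (mu j).
  apply/heqP/(heq_trans (heq_cast _ _ _)); apply: heq_vcomp (heq_cast _ _ _).
  by apply: (heq_family (mu i)) => //; rewrite comp1_idl.
have xy : x k = y k.
  apply: (vcomp_cancel (w := w) (n := n)) => // [|{kn}k kn].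
    by rewrite /w mu0; exact: Fhat_iso.
  apply: (@cast2_inj _ _ _ _ _ _ _ _ erefl et); apply/eqP.
  rewrite -subr_eq0 !(lin_conv (@cast2P _ _ _ _ _ _ _ _ _ _)) -conv_sub.
  apply/eqP; rewrite -(muA f (id1 Y) (id1 Y) kn).
  by apply: eq_conv => i j _; rewrite wE wE'.
apply: heq_trans (heq_sym (heq_idl _)) _; rewrite -unitary_id1.
apply: heq_trans (heq_sym (heq_cast (comp1A _ _ _) ex _)) _.
apply: heq_trans (eq_heq xy) _; exact: heq_cast.
Qed.

End Units.

Lemma deformation_extends n (d : ppDeformation F n.+1) :
  cohomologous (obstruction d) (cochain0 F (m := 2)) ->
  exists d' : ppDeformation F n.+2, extends d d'.
Proof.
case=> phi phi_nat phiP.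
pose mu := extend_family d (family_cochain phi).
have muA (X Y Z T : C) (f : mor X Y) (g : mor Y Z) (l : mor Z T) k :
    (k <= n.+2)%N -> associator f g l mu k = 0.
  rewrite leq_eqVlt => /predU1P[->|]; last first.
    by rewrite ltnS; exact: extend_family_associator.
  (* The top coefficient is the obstruction minus [delta phi], which vanishes by the choice of
     [phi]. *)
  by rewrite extend_family_associator_top -phiP subr0 subrr.
have mu_top : mu n.+2 = family_cochain phi by exact: extend_family_top.
have unit_src X : F1 F (id1 X) \o1 F1 F (id1 X) = F1 F (id1 X).
  by rewrite unitary_id1 comp1_idl.
have unit_tgt X : F1 F (id1 X \o1 id1 X) = id1 (F X).
  by rewrite comp1_idl unitary_id1.
(* The new unit coefficient is [phi (id, id)], transported along [F(id) F(id) = F(id)] and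
   [F(id id) = id]; lower orders are the given ones. *)
pose nu k X : two (F1 F (id1 X)) (id1 (F X)) :=
  if (k <= n.+1)%N then dunit d k X
  else cast2 (unit_src X) (unit_tgt X) (mu n.+2 _ _ _ (id1 X) (id1 X)).
have nu_low k X : (k <= n.+1)%N -> nu k X = dunit d k X by rewrite /nu => ->.
have nu_top X : nu n.+2 X =~ mu n.+2 _ _ _ (id1 X) (id1 X).
  by rewrite /nu ltnn; exact: heq_cast.
have mu_nat k : (1 <= k <= n.+2)%N -> natural_family (mu k).
  case/andP=> _; apply: extend_family_natural => X Y Z f f' g g' a b.
  exact: (phi_nat _ _ (existT _ Y (existT _ f (existT _ f' a),
                                   existT _ g (existT _ g' b)))).
have A1 X Y Z T (f : mor X Y) (g : mor Y Z) (l : mor Z T) k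
    (kn : (k <= n.+2)%N) :=
  (A1_associator mu f g l kn).2 (muA _ _ _ _ f g l _ kn).
have A2r (X Y : C) (f : mor X Y) :
    heqmod n.+2
      (hcast erefl (f_equal (@F1 _ _ _ F X Y) (comp1_idr f))
        (htrunc n.+2 (fun k => mu k _ _ _ (id1 X) f)))
      (hcast erefl (comp1_idr (F1 F f))
        (hhcomp (hconst (id2 (F1 F f))) (htrunc n.+2 (fun k => nu k X)))).
  move=> k kn; rewrite /hcast hhcomp_constl /htrunc kn.
  (* In the top order (A2) follows from the cancellation lemma; below it, from (A2) for [d]. *)
  move: (kn); rewrite leq_eqVlt => /predU1P[->|].
    apply: cast_heq; apply: heq_trans (heq_unitr _ muA _ _) _ => //.
    by apply: heq_hcomp (heq_refl _) _; exact/heq_sym/nu_top.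
  rewrite ltnS => kn1; have := dhat_A2r d f kn1.
  by rewrite /hcast hhcomp_constl /dhatP /dunitP /htrunc kn1
    /mu extend_familyE // nu_low.
have A2l (X Y : C) (f : mor X Y) :
    heqmod n.+2
      (hcast erefl (f_equal (@F1 _ _ _ F X Y) (comp1_idl f))
        (htrunc n.+2 (fun k => mu k _ _ _ f (id1 Y))))
      (hcast erefl (comp1_idl (F1 F f))
        (hhcomp (htrunc n.+2 (fun k => nu k Y)) (hconst (id2 (F1 F f))))).
  move=> k kn; rewrite /hcast hhcomp_constr /htrunc kn.
  move: (kn); rewrite leq_eqVlt => /predU1P[->|].
    apply: cast_heq; apply: heq_trans (heq_unitl _ muA _ _) _ => //.
    by apply: heq_hcomp (heq_refl _); exact/heq_sym/nu_top.
  rewrite ltnS => kn1; have := dhat_A2l d f kn1.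
  by rewrite /hcast hhcomp_constr /dhatP /dunitP /htrunc kn1
    /mu extend_familyE // nu_low.
unshelve eexists (@PPDeformation K C D F n.+2 mu nu _ _ mu_nat A1 A2r A2l) => //.
  by move=> X; rewrite nu_low // dunit0.
by move=> k kn; split=> *; [exact: extend_familyE | exact: nu_low].
Qed.

End Deformation.

Theorem theorem8p1 (K : fieldType) (C D : linTwoCat K) (F : pseudofunctor C D)
    (hF : unitary F) (n : nat) (hn : (1 <= n)%N) (d : ppDeformation F n) :
  cocycle (obstruction d) /\
  (cohomologous (obstruction d) (cochain0 F (m := 2)) ->
   exists d' : ppDeformation F n.+1, extends d d').
Proof.
case: n hn d => // n _ d.
by split; [exact: obstruction_cocycle | exact: deformation_extends].
Qed.
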